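(* Let $(A,\leq,0,1)$ be a finite bounded poset and $(T,R)$ a time frame with reflexive $R$. Then $P\leq_2P*F$, $F\leq_2F*P$, $H\leq_1H*P$, $G\leq_1G*P$, $P*H\leq_2P$, $F*H\leq_2F$, $H\leq_1H*F$, $G\leq_1G*F$, $P*G\leq_2P$, $F*G\leq_2F$, $H*G\leq_1H$, $G*H\leq_1G$.
   Context: For $D\subseteq A$: $L(D)$, $U(D)$ are the sets of lower and upper bounds; $\operatorname{Max}D$, $\operatorname{Min}D$ the sets of maximal and minimal elements. A time frame is $(T,R)$ with $T\neq\emptyset$, $R\subseteq T^2$. Tense operators on nonempty $B\subseteq A^T$ (with $q\in A^T$ identified with $\{q\}$) and $s\in T$: $P(B)(s)=\operatorname{Min}U(\{q(t)\mid q\in B,t\mathrel Rs\})$, $F(B)(s)=\operatorname{Min}U(\{q(t)\mid q\in B,s\mathrel Rt\})$, $H(B)(s)=\operatorname{Max}L(\{q(t)\mid q\in B,t\mathrel Rs\})$, $G(B)(s)=\operatorname{Max}L(\{q(t)\mid q\in B,s\mathrel Rt\})$, with values in $(2^A\setminus\{\emptyset\})^T$. The transformation function is $\varphi(x)=\{q\in A^T\mid q(t)\in x(t)\ \forall t\in T\}$, and for $X,Y\in\{P,F,H,G\}$, $X*Y:=X\circ\varphi\circ Y\colon A^T\to(2^A\setminus\{\emptyset\})^T$. For nonempty $D,E\subseteq A$: $D\leq_1E$ iff $\forall d\in D\,\exists e\in E: d\leq e$; $D\leq_2E$ iff $\forall e\in E\,\exists d\in D: d\leq e$. For maps $X,Y\colon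 A^T\to(2^A\setminus\{\emptyset\})^T$, $X\leq_iY$ means $X(q)(s)\leq_iY(q)(s)$ for all $q\in A^T$ and $s\in T$. *)

(* Defs.v *)
From mathcomp Require Import all_boot all_order.
From mathcomp Require Import boolp classical_sets.

Set Implicit Arguments.
Unset Strict Implicit.
Unset Printing Implicit Defensive.

Import Order.TTheory.

Local Open Scope classical_set_scope.
Local Open Scope order_scope.

(* The sets L(D) and U(D) are [lbound D] and [ubound D]. *)

Section Poset.
Context {d : Order.disp_t} {A : porderType d}.
Implicit Types D E : set A.

Definition Max D : set A := [set a | D a /\ ~ exists2 b, D b & a < b].
Definition Min D : set A := [set a | D a /\ ~ exists2 b, D b & b < a].

Definition set_le1 D E := forall x, D x -> exists2 y, E y & x <= y.
Definition set_le2 D E := forall y, E y -> exists2 x, D x & x <= y.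

End Poset.

(* Tense operators are total on sets of functions and take values in [set A].
   The lemmas below show that over a finite bounded poset their values, and
   those of the transformation function, are nonempty, so that they restrict to
   operators from nonempty subsets of A^T to (2^A \ {0})^T. *)

Definition tense_op {d : Order.disp_t} (A : porderType d) (T : Type) :=
  set (T -> A) -> T -> set A.

Section Tense.
Context {d : Order.disp_t} (A : porderType d) {T : Type} (R : T -> T -> Prop).

Definition past_values (B : set (T -> A)) (s : T) : set A :=
  [set a | exists q t, [/\ B q, R t s & a = q t]].
Definition future_values (B : set (T -> A)) (s : T) : set A :=
  [set a | exists q t, [/\ B q, R s t & a = q t]].

Definition tenseP : tense_op A T := fun B s => Min (ubound (past_values B s)).
Definition tenseF : tense_op A T := fun B s => Min (ubound (future_values B s)).
Definition tenseH : tense_op A T := fun B s => Max (lbound (past_values B s)).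
Definition tenseG : tense_op A T := fun B s => Max (lbound (future_values B s)).

End Tense.

Arguments tenseP {d} A {T} R B s.
Arguments tenseF {d} A {T} R B s.
Arguments tenseH {d} A {T} R B s.
Arguments tenseG {d} A {T} R B s.

Section Maps.
Context {d : Order.disp_t} {A : porderType d} {T : Type}.

(* A function q is identified with the singleton [set q]. *)
Definition on_fun (X : tense_op A T) : (T -> A) -> T -> set A :=
  fun q => X [set q].

Definition phi (x : T -> set A) : set (T -> A) := [set q | forall t, x t (q t)].

Definition star (X Y : tense_op A T) : (T -> A) -> T -> set A :=
  X \o phi \o on_fun Y.

Definition map_le1 (X Y : (T -> A) -> T -> set A) :=
  forall q s, set_le1 (X q s) (Y q s).
Definition map_le2 (X Y : (T -> A) -> T -> set A) :=
  forall q s, set_le2 (X q s) (Y q s).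

Lemma phi_neq0 (x : T -> set A) : (forall t, x t !=set0) -> phi x !=set0.
Proof.
by move=> x0; have [q qx] := choice x0; exists q.
Qed.

End Maps.

Section Nonempty.
Context {d : Order.disp_t} {A : finTBPOrderType d}.

Lemma Min_neq0 (D : set A) : D !=set0 -> Min D !=set0.
Proof.
move=> [a Da].
suff: forall n (x : A), (#|[pred y | (y < x)%O]| < n)%N -> D x -> Min D !=set0.
  by move=> /(_ _ a (ltnSn _) Da).
elim=> [//|n IHn] x ltxn Dx.
have [[b Db ltbx]|nb] := pselect (exists2 b, D b & b < x); last by exists x.
apply: (IHn b) => //; rewrite -ltnS; apply: leq_trans ltxn.
rewrite ltnS; apply: proper_card; apply/properP; split.
  by apply/fintype.subsetP => y; rewrite !inE => /lt_trans ->.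
by exists b; rewrite !inE ?ltxx.
Qed.

Lemma Max_neq0 (D : set A) : D !=set0 -> Max D !=set0.
Proof.
move=> [a Da].
suff: forall n (x : A), (#|[pred y | (x < y)%O]| < n)%N -> D x -> Max D !=set0.
  by move=> /(_ _ a (ltnSn _) Da).
elim=> [//|n IHn] x ltxn Dx.
have [[b Db ltxb]|nb] := pselect (exists2 b, D b & x < b); last by exists x.
apply: (IHn b) => //; rewrite -ltnS; apply: leq_trans ltxn.
rewrite ltnS; apply: proper_card; apply/properP; split.
  by apply/fintype.subsetP => y; rewrite !inE; apply: lt_trans.
by exists b; rewrite !inE ?ltxx.
Qed.

Context {T : Type} (R : T -> T -> Prop).
Implicit Types (B : set (T -> A)) (s : T).

Lemma tenseP_neq0 B s : tenseP A R B s !=set0.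
Proof. by apply: Min_neq0; exists \top => x _; apply: lex1. Qed.

Lemma tenseF_neq0 B s : tenseF A R B s !=set0.
Proof. by apply: Min_neq0; exists \top => x _; apply: lex1. Qed.

Lemma tenseH_neq0 B s : tenseH A R B s !=set0.
Proof. by apply: Max_neq0; exists \bot => x _; apply: le0x. Qed.

Lemma tenseG_neq0 B s : tenseG A R B s !=set0.
Proof. by apply: Max_neq0; exists \bot => x _; apply: le0x. Qed.

End Nonempty.

(* Main.v *)
(* Reflexivity puts [q s] among the values bounded by [P(q)(s)], [F(q)(s)],
   [H(q)(s)] and [G(q)(s)], so the selections of [P(q)] and [F(q)] lie pointwise
   above [q] and those of [H(q)] and [G(q)] below it.  The outer operators are
   monotone, because in a finite poset every element of a set lies above a
   minimal and below a maximal element of that set. *)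

Require Import Defs.
From mathcomp Require Import all_boot all_order.
From mathcomp Require Import classical_sets.

Import Order.TTheory.

Section FinitePoset.
Context {d : Order.disp_t} {A : finTBPOrderType d}.
Local Open Scope order_scope.

(** A minimal element of the part of [D] below [x] is minimal in all of [D]: anything in [D]
    strictly below it would also lie below [x]. *)
Lemma Min_le (D : set A) x : D x -> exists2 m, Min D m & m <= x.
Proof.
move=> Dx.
have [|m [[Dm lemx] minm]] := @Min_neq0 _ A [set y | D y /\ y <= x]%classic.
  by exists x.
exists m => //; split=> // -[b Db ltbm]; apply: minm; exists b => //.
by split=> //; apply: le_trans (ltW ltbm) lemx.
Qed.

Lemma Max_ge (D : set A) x : D x -> exists2 m, Max D m & x <= m.
Proof.
move=> Dx.
have [|m [[Dm lexm] maxm]] := @Max_neq0 _ A [set y | D y /\ x <= y]%classic.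
  by exists x.
exists m => //; split=> // -[b Db ltmb]; apply: maxm; exists b => //.
by split=> //; apply: le_trans lexm (ltW ltmb).
Qed.

Context {T : Type}.

(* Stated for [F] and [G] only: [P] and [H] are, by conversion, the operators
   [F] and [G] of the converse relation. *)
Lemma tenseF_le2 (R : T -> T -> Prop) (B C : set (T -> A)) s :
    (forall p t, B p -> exists2 r, C r & p t <= r t) ->
  set_le2 (tenseF A R B s) (tenseF A R C s).
Proof.
(* By [Min_le] it suffices that [y], an upper bound of the values of [C], also bounds those of
   [B]. *)
move=> leBC y [ubCy _]; apply: Min_le => _ [p [t [Bp Rst ->]]].
have [r Cr lepr] := leBC p t Bp.
by apply: le_trans lepr (ubCy _ _); exists r, t.
Qed.

(** A lower bound of the values of [B] is one for [C] too, since each [r t] has some [p t] below it;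
    [Max_ge] then extends it to a maximal one. *)
Lemma tenseG_le1 (R : T -> T -> Prop) (B C : set (T -> A)) s :
    (forall r t, C r -> exists2 p, B p & p t <= r t) ->
  set_le1 (tenseG A R B s) (tenseG A R C s).
Proof.
move=> leBC x [lbBx _]; apply: Max_ge => _ [r [t [Cr Rst ->]]].
have [p Bp lepr] := leBC r t Cr.
by apply: le_trans (lbBx _ _) lepr; exists p, t.
Qed.

Section Star.
Variables (R : T -> T -> Prop) (Y : tense_op A T).
Hypothesis Y_neq0 : forall q t, (on_fun Y q t !=set0)%classic.

Section Above.
Hypothesis Y_ge : forall q t x, on_fun Y q t x -> q t <= x.

Lemma tenseF_le_star : map_le2 (on_fun (tenseF A R)) (star (tenseF A R) Y).
Proof.
move=> q s; apply: tenseF_le2 => _ t ->.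
(* One selection of [on_fun Y q] suffices, as it dominates [q] at every time. *)
by have [r Yr] := phi_neq0 (Y_neq0 q); exists r => //; apply: Y_ge.
Qed.

Lemma tenseG_le_star : map_le1 (on_fun (tenseG A R)) (star (tenseG A R) Y).
Proof. by move=> q s; apply: tenseG_le1 => r t Yr; exists q => //; apply: Y_ge. Qed.

End Above.

Section Below.
Hypothesis Y_le : forall q t x, on_fun Y q t x -> x <= q t.

Lemma star_le_tenseF : map_le2 (star (tenseF A R) Y) (on_fun (tenseF A R)).
Proof. by move=> q s; apply: tenseF_le2 => p t Yp; exists q => //; apply: Y_le. Qed.

Lemma star_le_tenseG : map_le1 (star (tenseG A R) Y) (on_fun (tenseG A R)).
Proof.
move=> q s; apply: tenseG_le1 => _ t ->.
by have [p Yp] := phi_neq0 (Y_neq0 q); exists p => //; apply: Y_le.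
Qed.

End Below.
End Star.

Section Reflexive.
Variable R : T -> T -> Prop.
Hypothesis R_refl : forall t, R t t.

Lemma tenseF_ge q t x : on_fun (tenseF A R) q t x -> q t <= x.
Proof. by move=> [ubx _]; apply: ubx; exists q, t. Qed.

Lemma tenseG_le q t x : on_fun (tenseG A R) q t x -> x <= q t.
Proof. by move=> [lbx _]; apply: lbx; exists q, t. Qed.

End Reflexive.
End FinitePoset.

Theorem theorem11 (d : Order.disp_t) (A : finTBPOrderType d)
    (T : Type) (R : T -> T -> Prop)
    (T_nonempty : inhabited T) (R_refl : forall t : T, R t t) :
  let P := tenseP A R in
  let F := tenseF A R in
  let H := tenseH A R in
  let G := tenseG A R in
  (map_le2 (on_fun P) (star P F) /\ map_le2 (on_fun F) (star F P) /\
   map_le1 (on_fun H) (star H P) /\ map_le1 (on_fun G) (star G P)) /\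
  (map_le2 (star P H) (on_fun P) /\ map_le2 (star F H) (on_fun F) /\
   map_le1 (on_fun H) (star H F) /\ map_le1 (on_fun G) (star G F)) /\
  (map_le2 (star P G) (on_fun P) /\ map_le2 (star F G) (on_fun F) /\
   map_le1 (star H G) (on_fun H) /\ map_le1 (star G H) (on_fun G)).
Proof.
(* [P] and [H] are handled as [F] and [G] of [Rc]; [R_refl] serves for both relations because
   [Rc t t] unfolds to [R t t]. *)
move=> P F H G; pose Rc s t := R t s.
have P_ge : forall q t x, on_fun P q t x -> (q t <= x)%O := tenseF_ge Rc R_refl.
have F_ge : forall q t x, on_fun F q t x -> (q t <= x)%O := tenseF_ge R R_refl.
have H_le : forall q t x, on_fun H q t x -> (x <= q t)%O := tenseG_le Rc R_refl.
have G_le : forall q t x, on_fun G q t x -> (x <= q t)%O := tenseG_le R R_refl.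
have P0 q := @tenseP_neq0 _ A _ R (set1 q).
have F0 q := @tenseF_neq0 _ A _ R (set1 q).
have H0 q := @tenseH_neq0 _ A _ R (set1 q).
have G0 q := @tenseG_neq0 _ A _ R (set1 q).
(* The outer operator fixes the lemma and the choice of [R] or [Rc]; the inner one enters only
   through its bound relative to [q] and its nonempty values. *)
split; [|split].
- split; first exact: (tenseF_le_star Rc F F0 F_ge).
  split; first exact: (tenseF_le_star R P P0 P_ge).
  split; first exact: (tenseG_le_star Rc P P_ge).
  exact: (tenseG_le_star R P P_ge).
- split; first exact: (star_le_tenseF Rc H H_le).
  split; first exact: (star_le_tenseF R H H_le).
  split; first exact: (tenseG_le_star Rc F F_ge).
  exact: (tenseG_le_star R F F_ge).
- split; first exact: (star_le_tenseF Rc G G_le).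
  split; first exact: (star_le_tenseF R G G_le).
  split; first exact: (star_le_tenseG Rc G G0 G_le).
  exact: (star_le_tenseG R H H0 H_le).
Qed.
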